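(* Let $1\le h\le n$ and $0\le l\le h-1$ be integers, and let $Z_{a,b}^{(n,h,\lambda,\theta)}$ denote the coefficient of $j^ak^b$ in $q_{a+b}^{(n,h)}(j,k)$. Then $Z_{0,0}^{(n,h,\lambda,\theta)}=(\lambda\theta)^{n-1}\theta^{n-h}(1-\theta)^h$ and for any $0\le a\le h-l-1$ and $0\le b\le n-h$ with $(a,b)\ne(0,0)$, $$Z_{a,b}^{(n,h,\lambda,\theta)}=A_{a,b}^{(n,h,\lambda,\theta)}-\sum_{\substack{0\le u\le a,\ 0\le v\le b\\ 0\le u+v\le a+b-1}}Z_{u,v}^{(n,h,\lambda,\theta)}\,B_{a-u,b-v}^{(n,h,\theta)},$$ where $$A_{a,b}^{(n,h,\lambda,\theta)}=(-1)^a\sum_{i=0}^b\binom{n}{i}\binom{n}{b-i}\sum_{i_1+i_2+i_3+i_4+i_5=a}\binom{2}{i_1}\binom{h}{i_2}\binom{h}{i_3}\binom{n-i}{i_4}\binom{n-(b-i)}{i_5}2^{i_1}(1-\theta)^{h-i_3}(\theta\lambda)^{n-1-i-i_4}\theta^{(n-h)-(b-i)-i_5}$$ and $$B_{a,b}^{(n,h,\theta)}=(-1)^a\binom{n+h+1}{b}\sum_{j_1+j_2+j_3=a}\binom{1}{j_1}\binom{h}{j_2}\binom{n+h+1-b}{j_3}\frac{2^{j_1+j_3}}{\theta^{j_2}},$$ the inner sums being over nonnegative integers.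
   Context: Fix $\lambda\in(0,1]$, $\theta\in(0,1)$. $(x)_N=x(x+1)\cdots(x+N-1)$ is the Pochhammer symbol. For integers $1\le h\le n$ and $0\le l\le n-1$ define polynomials in $d$, with coefficients that are polynomials in the variables $j,k$: $$P_{n,h}(j,k,d)=(d-2j-1)(d+2h-2j-1)(d-j)_h((1-\theta)d-j)_h(\lambda\theta d+h-n-j+k)_n(\theta d+h-n-j+k)_n,$$ $$D_{n,h,l}(j,k,d)=\lambda\theta\, d^{l+1}(d+h-2j-1)(\theta d-j)_h(d-n+h-2j-1+k)_{n+h+1}.$$ $Q_{n,h,l}(j,k,d)$ is the quotient in the polynomial long division, with respect to the variable $d$, of $P_{n,h}(j,k,d)$ by $D_{n,h,l}(j,k,d)$; it has degree $n-l-1$ in $d$ and is written $Q_{n,h,l}(j,k,d)=\sum_{i=0}^{n-l-1}q^{(n,h)}_{n-l-1-i}(j,k)d^i$, where the $q_i^{(n,h)}(j,k)$, $0\le i\le n-l-1$, are polynomials in $j,k$ not depending on $l$. *)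

(* Defs.v *)
From HB Require Import structures.
From mathcomp Require Import all_boot all_order all_algebra.
From mathcomp Require Import ring zify.

Set Implicit Arguments.
Unset Strict Implicit.
Unset Printing Implicit Defensive.

Import Order.TTheory GRing.Theory Num.Theory.
Local Open Scope ring_scope.

Definition pochhammer (A : pzRingType) (x : A) (N : nat) : A :=
  \prod_(i < N) (x + i%:R).

(* R[k][j][d]: a polynomial in d whose coefficients are polynomials in j whose
   coefficients are polynomials in k. *)
Notation polyRing R := {poly {poly {poly R}}}.

Definition varD (R : nzRingType) : polyRing R := 'X.
Definition varJ (R : nzRingType) : polyRing R := 'X%:P.
Definition varK (R : nzRingType) : polyRing R := 'X%:P%:P.
Definition scalar (R : nzRingType) (c : R) : polyRing R := c%:P%:P%:P.

Definition Ppoly (R : realFieldType) (lam th : R) (n h : nat) : polyRing R :=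
  let j := varJ R in let k := varK R in let d := varD R in
  (d - 2 * j - 1) * (d + 2 * h%:R - 2 * j - 1)
  * pochhammer (d - j) h
  * pochhammer (scalar (1 - th) * d - j) h
  * pochhammer (scalar (lam * th) * d + h%:R - n%:R - j + k) n
  * pochhammer (scalar th * d + h%:R - n%:R - j + k) n.

Definition Dpoly (R : realFieldType) (lam th : R) (n h l : nat) : polyRing R :=
  let j := varJ R in let k := varK R in let d := varD R in
  scalar (lam * th) * d ^+ l.+1 * (d + h%:R - 2 * j - 1)
  * pochhammer (scalar th * d - j) h
  * pochhammer (d - n%:R + h%:R - 2 * j - 1 + k) (n + h + 1).

(* Over the integral domain of polynomials in j, k, [%/] is a pseudo-division
   in general; it is genuine long division here because the leading
   coefficient of the divisor is a nonzero scalar ([size_lead_Dpoly]). *)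
Definition Qpoly (R : realFieldType) (lam th : R) (n h l : nat) : polyRing R :=
  Ppoly lam th n h %/ Dpoly lam th n h l.

(* Meaningful for [l + i < n]; the value does not depend on [l] in that range
   ([qcoef_indep]). *)
Definition qcoef (R : realFieldType) (lam th : R) (n h l i : nat) :
    {poly {poly R}} :=
  (Qpoly lam th n h l)`_(n - l - 1 - i).

Definition Zcoef (R : realFieldType) (lam th : R) (n h l a b : nat) : R :=
  (qcoef lam th n h l (a + b))`_a`_b.

(* Some exponents are negative, hence the integer powers. *)
Definition Acoef (R : realFieldType) (lam th : R) (n h a b : nat) : R :=
  (-1) ^+ a *
  \sum_(i < b.+1) 'C(n, i)%:R * 'C(n, b - i)%:R *
    \sum_(i1 < a.+1) \sum_(i2 < a.+1) \sum_(i3 < a.+1) \sum_(i4 < a.+1)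
    \sum_(i5 < a.+1 | (i1 + i2 + i3 + i4 + i5 == a)%N)
      'C(2, i1)%:R * 'C(h, i2)%:R * 'C(h, i3)%:R * 'C(n - i, i4)%:R
      * 'C(n - (b - i), i5)%:R * 2 ^+ i1
      * (1 - th) ^ (h%:Z - i3%:Z)
      * (th * lam) ^ (n%:Z - 1 - i%:Z - i4%:Z)
      * th ^ ((n%:Z - h%:Z) - (b%:Z - i%:Z) - i5%:Z).

Definition Bcoef (R : realFieldType) (th : R) (n h a b : nat) : R :=
  (-1) ^+ a * 'C(n + h + 1, b)%:R *
  \sum_(j1 < a.+1) \sum_(j2 < a.+1)
  \sum_(j3 < a.+1 | (j1 + j2 + j3 == a)%N)
    'C(1, j1)%:R * 'C(h, j2)%:R * 'C(n + h + 1 - b, j3)%:R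
    * (2 ^+ (j1 + j3) / th ^+ j2).

Lemma size_lead_linear (A : idomainType) (c e : A) :
  c != 0 -> size (c%:P * 'X + e%:P) = 2%N /\ lead_coef (c%:P * 'X + e%:P) = c.
Proof.
move=> c0; have sX : size (c%:P * 'X) = 2%N.
  by rewrite size_Cmul // size_polyX.
have sE : (size (e%:P : {poly A}) < size (c%:P * 'X)%R)%N.
  by rewrite sX ltnS size_polyC_leq1.
by rewrite size_polyDl // lead_coefDl // lead_coefM lead_coefC lead_coefX mulr1.
Qed.

Lemma size_lead_pochhammer (A : idomainType) (c e : A) (p : {poly A}) N :
  c != 0 -> p = c%:P * 'X + e%:P ->
  size (pochhammer p N) = N.+1 /\ lead_coef (pochhammer p N) = c ^+ N.
Proof.
move=> c0 pE; elim: N => [|N [sN lN]].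
  by rewrite /pochhammer big_ord0 size_poly1 lead_coef1.
rewrite /pochhammer big_ord_recr /= -/(pochhammer p N).
have [sF lF] := @size_lead_linear A c (e + N%:R) c0.
have -> : p + N%:R = c%:P * 'X + (e + N%:R)%:P.
  by rewrite pE polyCD polyC_natr addrA.
rewrite lead_coefM lN lF exprSr; split=> //.
rewrite size_mul ?sN ?sF ?addn2 //; first by rewrite -size_poly_gt0 sN.
by rewrite -size_poly_gt0 sF.
Qed.

Lemma size_mul_succ (A : idomainType) (p q : {poly A}) a b :
  size p = a.+1 -> size q = b.+1 -> size (p * q) = (a + b).+1.
Proof.
move=> sp sq; rewrite size_mul -?size_poly_gt0 ?sp ?sq //.
by rewrite addSn addnS.
Qed.

Ltac linear_form :=
  rewrite /scalar /varD /varJ /varK ?(polyCD, polyCN, polyCM, polyC1, polyC_natr);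
  ring.

Lemma size_lead_Dpoly (R : realFieldType) (lam th : R) n h l :
    0 < lam -> 0 < th ->
  size (Dpoly lam th n h l) = (l + n + 2 * h + 4)%N /\
  lead_coef (Dpoly lam th n h l) = (lam * th * th ^+ h)%:P%:P.
Proof.
move=> lam0 th0.
have lt0 : (lam * th)%:P%:P != 0 :> {poly {poly R}}.
  by rewrite !polyC_eq0 mulf_neq0 // gt_eqF.
have t0 : th%:P%:P != 0 :> {poly {poly R}} by rewrite !polyC_eq0 gt_eqF.
have n0 : (1 : {poly {poly R}}) != 0 by rewrite oner_eq0.
have [s1 e1] := @size_lead_linear _ 1 (h%:R - 2 * 'X - 1 : {poly {poly R}}) n0.
have E1 : varD R + h%:R - 2 * varJ R - 1 =
  1%:P * 'X + (h%:R - 2 * 'X - 1)%:P by linear_form.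
have E2 : scalar th * varD R - varJ R = th%:P%:P%:P * 'X + (- 'X)%:P.
  by linear_form.
have [s2 e2] := size_lead_pochhammer h t0 E2.
have E3 : varD R - n%:R + h%:R - 2 * varJ R - 1 + varK R =
  1%:P * 'X + (- n%:R + h%:R - 2 * 'X - 1 + 'X%:P)%:P by linear_form.
have [s3 e3] := size_lead_pochhammer (n + h + 1) n0 E3.
rewrite /Dpoly E1; split; last first.
  rewrite !lead_coefM e1 e2 e3 lead_coefXn /scalar lead_coefC.
  by rewrite expr1n !mulr1 !polyCM -!polyC_exp.
have sc : size (scalar (lam * th)) = 1%N by rewrite size_polyC lt0.
have sX : size ('X^(l.+1) : polyRing R) = l.+2 by rewrite size_polyXn.
have S := size_mul_succ (size_mul_succ (size_mul_succ (size_mul_succ sc sX) s1)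
  s2) s3.
by rewrite S; lia.
Qed.

Lemma size_Ppoly (R : realFieldType) (lam th : R) n h :
    0 < lam -> 0 < th -> th < 1 ->
  size (Ppoly lam th n h) = (2 * n + 2 * h + 3)%N.
Proof.
move=> lam0 th0 th1.
have cnz (c : R) : c != 0 -> c%:P%:P != 0 :> {poly {poly R}}.
  by move=> c0; rewrite !polyC_eq0.
have lt0 : (lam * th)%:P%:P != 0 :> {poly {poly R}}.
  by apply: cnz; rewrite mulf_neq0 // gt_eqF.
have t0 : th%:P%:P != 0 :> {poly {poly R}} by apply: cnz; rewrite gt_eqF.
have t10 : (1 - th)%:P%:P != 0 :> {poly {poly R}}.
  by apply: cnz; rewrite subr_eq0 gt_eqF.
have n0 : (1 : {poly {poly R}}) != 0 by rewrite oner_eq0.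
have [s1 _] := @size_lead_linear _ 1 (- (2 * 'X) - 1 : {poly {poly R}}) n0.
have E1 : varD R - 2 * varJ R - 1 = 1%:P * 'X + (- (2 * 'X) - 1)%:P.
  by linear_form.
have [s2 _] :=
  @size_lead_linear _ 1 (2 * h%:R - 2 * 'X - 1 : {poly {poly R}}) n0.
have E2 : varD R + 2 * h%:R - 2 * varJ R - 1 =
  1%:P * 'X + (2 * h%:R - 2 * 'X - 1)%:P by linear_form.
have E3 : varD R - varJ R = 1%:P * 'X + (- 'X)%:P by linear_form.
have [s3 _] := size_lead_pochhammer h n0 E3.
have E4 : scalar (1 - th) * varD R - varJ R =
  (1 - th)%:P%:P%:P * 'X + (- 'X)%:P by linear_form.
have [s4 _] := size_lead_pochhammer h t10 E4.
have E5 : scalar (lam * th) * varD R + h%:R - n%:R - varJ R + varK R =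
  (lam * th)%:P%:P%:P * 'X + (h%:R - n%:R - 'X + 'X%:P)%:P by linear_form.
have [s5 _] := size_lead_pochhammer n lt0 E5.
have E6 : scalar th * varD R + h%:R - n%:R - varJ R + varK R =
  th%:P%:P%:P * 'X + (h%:R - n%:R - 'X + 'X%:P)%:P by linear_form.
have [s6 _] := size_lead_pochhammer n t0 E6.
rewrite /Ppoly E1 E2.
have S := size_mul_succ (size_mul_succ (size_mul_succ (size_mul_succ
  (size_mul_succ s1 s2) s3) s4) s5) s6.
by rewrite S; lia.
Qed.

Lemma lead_Dpoly_unit (R : realFieldType) (lam th : R) n h l :
  0 < lam -> 0 < th -> lead_coef (Dpoly lam th n h l) \is a GRing.unit.
Proof.
move=> lam0 th0; have [_ ->] := size_lead_Dpoly n h l lam0 th0.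
by rewrite !rmorph_unit // unitfE !mulf_neq0 ?expf_neq0 ?gt_eqF.
Qed.

Lemma Qpoly_long_division (R : realFieldType) (lam th : R) n h l :
    0 < lam -> 0 < th ->
  exists2 r : polyRing R, (size r < size (Dpoly lam th n h l))%N &
    Ppoly lam th n h = Qpoly lam th n h l * Dpoly lam th n h l + r.
Proof.
move=> lam0 th0; have uD := lead_Dpoly_unit n h l lam0 th0.
exists (Ppoly lam th n h %% Dpoly lam th n h l).
  by rewrite ltn_modp -lead_coef_eq0; apply: contraTneq uD => ->; rewrite unitr0.
by rewrite /Qpoly -(Pdiv.IdomainUnit.divp_eq uD).
Qed.

Lemma size_Qpoly (R : realFieldType) (lam th : R) n h l :
    0 < lam -> 0 < th -> th < 1 -> (l < n)%N ->
  size (Qpoly lam th n h l) = (n - l)%N.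
Proof.
move=> lam0 th0 th1 ln; rewrite /Qpoly size_divp ?size_Ppoly //.
  by have [-> _] := size_lead_Dpoly n h l lam0 th0; lia.
by rewrite -size_poly_gt0; have [-> _] := size_lead_Dpoly n h l lam0 th0; lia.
Qed.

Lemma qcoef_indep (R : realFieldType) (lam th : R) n h l i :
    0 < lam -> 0 < th -> (l + i < n)%N ->
  qcoef lam th n h l i = qcoef lam th n h 0 i.
Proof.
move=> lam0 th0 lin.
have DE : Dpoly lam th n h l = Dpoly lam th n h 0 * 'X^l.
  rewrite /Dpoly [varD R ^+ l.+1]exprS expr1 {1 2 3}/varD -/(varD R); ring.
rewrite /qcoef /Qpoly DE -Pdiv.IdomainUnit.divp_divl.
- rewrite -Pdiv.IdomainMonic.drop_poly_divp coef_drop_poly; congr (_`_ _); lia.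
- by rewrite lead_coefXn unitr1.
- exact: lead_Dpoly_unit.
Qed.

(* Main.v *)
Require Import Defs.
From mathcomp Require Import all_boot all_order all_algebra.
From mathcomp Require Import ring zify.
Import Order.TTheory GRing.Theory Num.Theory.
Local Open Scope ring_scope.

(** The polynomials [P] and [D] have total degrees [M + N] and [N] in [d], [j],
    [k], where [M = n - l - 1] and [N = l + n + 2h + 3] is also the degree of
    [D] in [d]. The number [Z_(a,b)] is the coefficient of
    [d^(M-a-b) j^a k^b] in the quotient [Q], a monomial of total degree [M].
    So the recursion is a statement about homogeneous parts of top degree, in
    which all the constant shifts [i], [h], [n], [1] of the factors of [P] and
    [D] disappear: the top parts are
      [Ptop = (d-2j)^2 (d-j)^h ((1-th)d-j)^h (lam th d-j+k)^n (th d-j+k)^n],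
      [Dtop = lam th d^(l+1) (d-2j) (th d-j)^h (d-2j+k)^(n+h+1)].

    The quotient has total degree at most [M] ([top_quotient]). Otherwise let
    [z] be its top part, of degree [m > M]. In [P = Q D + r] the part of degree
    [m + N] of [P] vanishes, so the corresponding part of [r] is [- z Dtop].
    But [Dtop] contains [d^N] with a nonzero coefficient, so [z Dtop] has degree
    at least [N] in [d], whereas [r] has smaller degree in [d].

    Hence [Ptop = Qtop Dtop + rtop]. The monomials [d^(M+N-a-b) j^a k^b] with
    [a + b <= M] do not occur in [rtop], because their degree in [d] is at least
    [N]. Setting [d = 1] loses no information on homogeneous polynomials, and
    comparing the coefficients of [j^a k^b] then gives
      [A_(a,b) = sum of Z_(u,v) B_(a-u,b-v) over u <= a, v <= b]
    ([Acoef_convolution]), since by the binomial theorem the coefficients of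
    [Ptop] and [Dtop] at [d = 1] are [lam th th^h A] and [lam th th^h B]
    ([coef_Ptop_Acoef], [coef_Dtop_Bcoef]). As [B_(0,0) = 1], the term
    [(u,v) = (a,b)] can be isolated, which is the claimed recursion. *)

Set Implicit Arguments.
Unset Strict Implicit.

(** * Homogeneous components *)

(** One variable at a time, this builds the morphism that multiplies every
    variable by a new outermost variable [s]: if [f] already does so for the
    variables of [A], then [grade_ext f] also sends ['X] to ['X * s]. *)
Definition grade_ext (A B : comNzRingType) (f : {rmorphism A -> {poly B}}) :
    {rmorphism {poly A} -> {poly {poly B}}} :=
  horner_eval ('X%:P * 'X) \o map_poly (map_poly polyC \o f).

Arguments grade_ext : simpl never.

Lemma grade_extX (A B : comNzRingType) (f : {rmorphism A -> {poly B}}) :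
  grade_ext f 'X = 'X%:P * 'X.
Proof. by rewrite /grade_ext /= map_polyX horner_evalE hornerX. Qed.

Lemma grade_extC (A B : comNzRingType) (f : {rmorphism A -> {poly B}}) c :
  grade_ext f c%:P = map_poly polyC (f c).
Proof. by rewrite /grade_ext /= map_polyC horner_evalE hornerC. Qed.

Lemma coef_grade_ext (A B : comNzRingType) (f : {rmorphism A -> {poly B}})
    (p : {poly A}) m i :
  (grade_ext f p)`_m`_i = if (i <= m)%N then (f p`_i)`_(m - i) else 0.
Proof.
elim/poly_ind: p m i => [|p c IH] m i; first by rewrite raddf0 !coef0 raddf0 coef0 if_same.
rewrite rmorphD rmorphM grade_extX grade_extC mulrA.
rewrite coefD coefD coefMX coef_map coefC coefD coefMX coefC.
case: m => [|m] /=.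
  rewrite coef0 add0r; case: i => [|i] //=.
  by rewrite add0r subnn.
rewrite coefMC coefMX.
case: i => [|i] //=; first by rewrite !add0r subn0.
by rewrite addr0 IH ltnS subSS addr0.
Qed.

(** The morphism [d, j, k |-> d s, j s, k s]: the coefficient of [s^m] in the
    image of a polynomial is its homogeneous component of degree [m]. Total
    degree thus becomes the degree of an ordinary univariate polynomial over an
    integral domain. *)
Definition grade (R : comNzRingType) :
    {rmorphism polyRing R -> {poly polyRing R}} :=
  grade_ext (grade_ext (grade_ext polyC)).

Lemma coef_grade (R : comNzRingType) (p : polyRing R) m i a b :
  (grade R p)`_m`_i`_a`_b = if (i + a + b == m)%N then p`_i`_a`_b else 0.
Proof.
rewrite /grade /= coef_grade_ext; case: leqP => im; last first.
  by rewrite !coef0; case: eqP => //; lia.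
rewrite coef_grade_ext; case: leqP => am; last first.
  by rewrite coef0; case: eqP => //; lia.
rewrite coef_grade_ext; case: leqP => bm; last by case: eqP => //; lia.
by rewrite coefC; do 2 case: eqP => //; lia.
Qed.

Lemma size_coef_grade (R : comNzRingType) (p : polyRing R) m :
  (size ((grade R p)`_m)%R <= size p)%N.
Proof.
apply/leq_sizeP => i pi; rewrite /grade /= coef_grade_ext.
by rewrite (nth_default _ pi) raddf0 coef0 if_same.
Qed.

(** For [g := grade R]: [p] has total degree at most [N], and [x] is its
    component of degree [N], possibly zero. The grading morphism is kept
    abstract so that the calculus below never unfolds nested polynomials. *)
Definition has_top (A : comNzRingType) (g : {rmorphism A -> {poly A}})
    (N : nat) (p x : A) :=
  (size (g p) <= N.+1)%N /\ (g p)`_N = x.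

Lemma coefM_top (A : nzRingType) (p q : {poly A}) m n :
  (size p <= m.+1)%N -> (size q <= n.+1)%N -> (p * q)`_(m + n) = p`_m * q`_n.
Proof.
move=> sp sq; have mn : (m < (m + n).+1)%N by lia.
rewrite coefM (bigD1 (Ordinal mn)) //= addKn big1 ?addr0 // => i /eqP ni.
have {}ni : i <> m :> nat by move=> E; apply: ni; apply: val_inj.
have [im|mi] := ltnP i m.
  by rewrite [q`_ _]nth_default ?mulr0 //; apply: leq_trans sq _; lia.
by rewrite [p`_ _]nth_default ?mul0r //; apply: leq_trans sp _; lia.
Qed.

Lemma size_polyM_top (A : nzRingType) (p q : {poly A}) m n :
  (size p <= m.+1)%N -> (size q <= n.+1)%N -> (size (p * q)%R <= (m + n).+1)%N.
Proof. by move=> sp sq; apply: leq_trans (size_polyMleq _ _) _; lia. Qed.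

Section HasTop.
Variables (A : comNzRingType) (g : {rmorphism A -> {poly A}}).
Local Notation has_top := (has_top g).

Lemma has_topM M N p x q y :
  has_top M p x -> has_top N q y -> has_top (M + N) (p * q) (x * y).
Proof.
move=> [sp <-] [sq <-].
by rewrite /has_top rmorphM coefM_top //; split=> //; apply: size_polyM_top.
Qed.

Lemma has_topX m N p x : has_top m p x -> has_top (m * N) (p ^+ N) (x ^+ N).
Proof.
move=> tp; elim: N => [|N IH].
  by rewrite muln0; split; rewrite rmorph1 ?size_poly1 // coef1.
by rewrite mulnS !exprS; apply: has_topM.
Qed.

Lemma has_topD N p x q y :
  has_top N p x -> has_top N q y -> has_top N (p + q) (x + y).
Proof.
move=> [sp <-] [sq <-]; split; rewrite rmorphD ?coefD //.
by apply: leq_trans (size_polyD _ _) _; rewrite geq_max sp.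
Qed.

Lemma has_topN N p x : has_top N p x -> has_top N (- p) (- x).
Proof. by move=> [sp <-]; split; rewrite rmorphN ?size_polyN ?coefN. Qed.

Lemma has_topB N p x q y :
  has_top N p x -> has_top N q y -> has_top N (p - q) (x - y).
Proof. by move=> tp /has_topN; apply: has_topD. Qed.

Lemma has_top_lower N p x : has_top N p x -> has_top N.+1 p 0.
Proof. by move=> [sp _]; split; [exact: leqW | rewrite nth_default]. Qed.

Lemma has_top_const x : g x = x%:P -> has_top 0 x x.
Proof. by move=> E; rewrite /has_top E size_polyC_leq1 coefC. Qed.

Lemma has_top_var x : g x = x%:P * 'X -> has_top 1 x x.
Proof.
move=> E; rewrite /has_top E coefCM coefX mulr1; split=> //.
rewrite (leq_trans (size_polyMleq _ _)) // size_polyX addn2 /=.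
by rewrite ltnS size_polyC_leq1.
Qed.

Lemma has_top_nat m : has_top 0 m%:R m%:R.
Proof. by apply: has_top_const; rewrite rmorph_nat polyC_natr. Qed.

(** Constant shifts of a linear form do not affect its top part; this is what
    makes a Pochhammer product look like a power. *)
Lemma has_top_shift p x c z : has_top 1 p x -> has_top 0 c z -> has_top 1 (p + c) x.
Proof.
by move=> tp /has_top_lower tc; rewrite -[x]addr0; apply: has_topD.
Qed.

Lemma has_top_pochhammer p x N :
  has_top 1 p x -> has_top N (pochhammer p N) (x ^+ N).
Proof.
move=> tp; elim: N => [|N IH].
  by rewrite /pochhammer big_ord0; apply: (has_top_nat 1).
rewrite /pochhammer big_ord_recr /= exprSr -addn1; apply: has_topM => //.
exact: has_top_shift (has_top_nat _).
Qed.

End HasTop.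

Lemma has_top_scalar (R : comNzRingType) (c : R) :
  has_top (grade R) 0 (Defs.scalar c) (Defs.scalar c).
Proof.
by apply: has_top_const; rewrite /grade /Defs.scalar !grade_extC !map_polyC.
Qed.

Lemma has_top_varD (R : comNzRingType) :
  has_top (grade R) 1 (varD R) (varD R).
Proof. by apply: has_top_var; rewrite /grade grade_extX. Qed.

Lemma has_top_varJ (R : comNzRingType) :
  has_top (grade R) 1 (varJ R) (varJ R).
Proof.
apply: has_top_var; rewrite /grade grade_extC grade_extX.
by rewrite rmorphM /= map_polyC map_polyX.
Qed.

Lemma has_top_varK (R : comNzRingType) :
  has_top (grade R) 1 (varK R) (varK R).
Proof.
apply: has_top_var; rewrite /grade !grade_extC grade_extX.
by rewrite rmorphM /= map_polyC map_polyX rmorphM /= map_polyC map_polyX.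
Qed.

(** * Total degree of the quotient *)

(** If the quotient has too large a total degree, its top part [z] creates a
    component of [q * d] that [p] is too small to cancel, so the remainder must
    cancel it. *)
Lemma quotient_overflow (A : idomainType) (g : {rmorphism A -> {poly A}})
    (p q d r x y : A) M N :
  p = q * d + r -> has_top g (M + N) p x -> has_top g N d y ->
  (M.+1 < size (g q))%N ->
  exists m, exists2 z, z != 0 & (g r)`_m = - (z * y).
Proof.
move=> defp [sp _] [sd topd] ltMq.
have q0 : g q != 0 by rewrite -size_poly_gt0; apply: leq_trans ltMq.
pose e := (size (g q)).-1.
have sq : size (g q) = e.+1 by rewrite prednK // size_poly_gt0.
exists (e + N)%N, (lead_coef (g q)); rewrite ?lead_coef_eq0 //.
have : (g p)`_(e + N) = 0.
  by apply: nth_default; apply: leq_trans sp _; lia.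
rewrite defp rmorphD rmorphM coefD coefM_top ?sq // topd addrC.
by move/eqP; rewrite addr_eq0 => /eqP.
Qed.

Lemma leq_size_mull (A : idomainType) (p q : {poly A}) :
  p != 0 -> (size q <= size (p * q)%R)%N.
Proof.
move=> p0; have [->|q0] := eqVneq q 0; first by rewrite size_poly0.
by rewrite size_mul //; move: p0; rewrite -size_poly_gt0; lia.
Qed.

(** The remainder cannot cancel [z * y]: by hypothesis on [D], the top part
    [y] contains [d^N], so [z * y] has degree at least [N] in [d], more than any
    component of [r]. *)
Lemma top_quotient (R : idomainType) (P Q D r x y : polyRing R) M N :
  P = Q * D + r -> (size r <= N)%N -> has_top (grade R) (M + N) P x ->
  has_top (grade R) N D y -> D`_N`_0`_0 != 0 ->
  exists z, has_top (grade R) M Q z.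
Proof.
move=> defP szr tP tD lD.
have sy : (N < size y)%N.
  rewrite ltnNge; apply: contra lD => sy; apply/eqP.
  have := coef_grade D N N 0 0; case: tD => _ ->.
  by rewrite !addn0 eqxx (nth_default _ sy) !coef0.
suff sQ : (size (grade R Q) <= M.+1)%N by exists (grade R Q)`_M.
rewrite leqNgt; apply/negP => /(quotient_overflow defP tP tD).
move=> [m [z z0 rm]]; have := leq_trans (size_coef_grade r m) szr.
rewrite rm size_polyN leqNgt => /negP; apply.
apply: leq_trans sy _.
exact: leq_size_mull.
Qed.

(** * The top parts of P and D *)

(** Sets [d = 1] and makes [k] the outer variable, because the expansions in
    powers of [k] come first when the coefficients are computed. *)
Definition dehomogenize (R : comNzRingType) :
    {rmorphism polyRing R -> {poly {poly R}}} :=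
  @swapXY R \o horner_eval 1.

(** On a homogeneous polynomial of degree [N], setting [d = 1] merges no
    monomials: the exponent of [d] is determined by those of [j] and [k]. *)
Lemma coef_dehomogenize (R : comNzRingType) (p x : polyRing R) N a b :
  has_top (grade R) N p x ->
  (dehomogenize R x)`_b`_a = if (a + b <= N)%N then p`_(N - (a + b))`_a`_b else 0.
Proof.
move=> [_ topx].
have cx i : x`_i`_a`_b = if (i + a + b == N)%N then p`_i`_a`_b else 0.
  by rewrite -topx coef_grade.
rewrite /dehomogenize /= coef_swapXY horner_evalE.
rewrite (@horner_coef_wide _ (maxn (size x) N.+1)) ?leq_maxl //.
under eq_bigr do rewrite expr1n mulr1.
rewrite !coef_sum.
under eq_bigr do rewrite cx.
case: leqP => abN.
  have iN : (N - (a + b) < maxn (size x) N.+1)%N by lia.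
  rewrite (bigD1 (Ordinal iN)) //= ifT; last by lia.
  rewrite big1 ?addr0 // => i /eqP ne; case: eqP => // E.
  by case: ne; apply: val_inj => /=; lia.
by rewrite big1 // => i _; case: eqP => //; lia.
Qed.

(** The top parts, over an arbitrary ring, so that they can be moved along ring
    morphisms and specialized to [d = 1]; [c1], [c2], [c3] stand for [1 - th],
    [lam * th], [th]. *)
Definition Ptop (A : comNzRingType) (d j k c1 c2 c3 : A) (n h : nat) : A :=
  (d - 2 * j) ^+ 2 * (d - j) ^+ h * (c1 * d - j) ^+ h
  * (c2 * d - j + k) ^+ n * (c3 * d - j + k) ^+ n.

Definition Dtop (A : comNzRingType) (d j k c2 c3 : A) (n h l : nat) : A :=
  c2 * d ^+ l.+1 * (d - 2 * j) * (c3 * d - j) ^+ h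
  * (d - 2 * j + k) ^+ (n + h + 1).

Lemma rmorph_Ptop (A B : comNzRingType) (f : {rmorphism A -> B})
    d j k c1 c2 c3 n h :
  f (Ptop d j k c1 c2 c3 n h) =
  Ptop (f d) (f j) (f k) (f c1) (f c2) (f c3) n h.
Proof. by rewrite /Ptop !(rmorphM, rmorphXn, rmorphD, rmorphN, rmorph1). Qed.

Lemma rmorph_Dtop (A B : comNzRingType) (f : {rmorphism A -> B})
    d j k c2 c3 n h l :
  f (Dtop d j k c2 c3 n h l) = Dtop (f d) (f j) (f k) (f c2) (f c3) n h l.
Proof. by rewrite /Dtop !(rmorphM, rmorphXn, rmorphD, rmorphN, rmorph1). Qed.

Lemma has_top_Ppoly (R : realFieldType) (lam th : R) n h :
  has_top (grade R) (2 * n + 2 * h + 2) (Ppoly lam th n h)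
    (Ptop (varD R) (varJ R) (varK R) (Defs.scalar (1 - th))
       (Defs.scalar (lam * th)) (Defs.scalar th) n h).
Proof.
rewrite /Ptop /Ppoly; cbv zeta.
have tN m := has_top_nat (grade R) m.
move: (varD R) (varJ R) (varK R)
  (has_top_varD R) (has_top_varJ R) (has_top_varK R) => d j k tD tJ tK.
have tcDJ c : has_top (grade R) 1 (Defs.scalar c * d - j) (Defs.scalar c * d - j).
  exact: has_topB (has_topM (has_top_scalar c) tD) tJ.
have tcDJK c := has_topD (tcDJ c) tK.
have tD2J : has_top (grade R) 1 (d - 2 * j) (d - 2 * j).
  exact: has_topB tD (has_topM (tN 2) tJ).
have E2 : d + 2 * h%:R - 2 * j - 1 = d - 2 * j + (2 * h%:R - 1) by ring.
have EK c : Defs.scalar c * d + h%:R - n%:R - j + k =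
  Defs.scalar c * d - j + k + (h%:R - n%:R) by ring.
rewrite E2.
rewrite expr2.
have -> : (2 * n + 2 * h + 2 = 1 + 1 + h + h + n + n)%N by lia.
have tnh := has_topB (tN h) (tN n).
apply: has_topM; last first.
  by apply: has_top_pochhammer; rewrite EK; apply: has_top_shift (tcDJK _) tnh.
apply: has_topM; last first.
  by apply: has_top_pochhammer; rewrite EK; apply: has_top_shift (tcDJK _) tnh.
apply: has_topM; last exact: has_top_pochhammer (tcDJ _).
apply: has_topM; last exact: has_top_pochhammer (has_topB tD tJ).
apply: has_topM; first exact: has_top_shift tD2J (has_topN (tN 1)).
exact: has_top_shift tD2J (has_topB (has_topM (tN 2) (tN h)) (tN 1)).
Qed.

Lemma has_top_Dpoly (R : realFieldType) (lam th : R) n h l :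
  has_top (grade R) (l + n + 2 * h + 3) (Dpoly lam th n h l)
    (Dtop (varD R) (varJ R) (varK R)
       (Defs.scalar (lam * th)) (Defs.scalar th) n h l).
Proof.
rewrite /Dtop /Dpoly; cbv zeta.
have tN m := has_top_nat (grade R) m.
move: (varD R) (varJ R) (varK R)
  (has_top_varD R) (has_top_varJ R) (has_top_varK R) => d j k tD tJ tK.
have tD2J : has_top (grade R) 1 (d - 2 * j) (d - 2 * j).
  exact: has_topB tD (has_topM (tN 2) tJ).
have E1 : d + h%:R - 2 * j - 1 = d - 2 * j + (h%:R - 1) by ring.
have E2 : d - n%:R + h%:R - 2 * j - 1 + k = d - 2 * j + k + (h%:R - 1 - n%:R).
  by ring.
rewrite E1 E2.
have -> : (l + n + 2 * h + 3 = 0 + 1 * l.+1 + 1 + h + (n + h + 1))%N by lia.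
have th1 := has_topB (tN h) (tN 1).
apply: has_topM; last first.
  exact: has_top_pochhammer (has_top_shift (has_topD tD2J tK) (has_topB th1 (tN n))).
apply: has_topM; last first.
  exact: has_top_pochhammer (has_topB (has_topM (has_top_scalar _) tD) tJ).
apply: has_topM; last exact: has_top_shift tD2J th1.
exact: has_topM (has_top_scalar _) (has_topX _ tD).
Qed.

(** * Coefficients of the top parts *)

Lemma dehomogenize_varD (R : comNzRingType) : dehomogenize R (varD R) = 1.
Proof. by rewrite /dehomogenize /varD /= horner_evalE hornerX rmorph1. Qed.

Lemma dehomogenize_varJ (R : comNzRingType) : dehomogenize R (varJ R) = 'X%:P.
Proof. by rewrite /dehomogenize /varJ /= horner_evalE hornerC swapXY_X. Qed.

Lemma dehomogenize_varK (R : comNzRingType) : dehomogenize R (varK R) = 'X.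
Proof. by rewrite /dehomogenize /varK /= horner_evalE hornerC swapXY_Y. Qed.

Lemma dehomogenize_scalar (R : comNzRingType) (c : R) :
  dehomogenize R (Defs.scalar c) = c%:P%:P.
Proof.
by rewrite /dehomogenize /Defs.scalar /= horner_evalE hornerC swapXY_polyC map_polyC.
Qed.

Lemma coef_linear_exp (A : comNzRingType) (c e : A) N i :
  ((c%:P + e%:P * 'X) ^+ N)`_i = 'C(N, i)%:R * (c ^+ (N - i) * e ^+ i).
Proof.
rewrite exprDn coef_sum.
under eq_bigr => m _ do
  rewrite exprMn -!rmorphXn mulrA -rmorphM coefMn coefCM coefXn mulr_natr mulrb.
case: (leqP i N) => iN.
  rewrite (bigD1 (Ordinal (iN : i < N.+1)%N)) //= eqxx mulr_natl big1 ?addr0 //.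
  by move=> m /eqP ne; case: eqP => [E|_]; rewrite ?mul0rn //; case: ne; apply: val_inj.
rewrite bin_small // mul0r big1 // => m _.
by case: eqP => [E|_]; rewrite ?mul0rn //; have := ltn_ord m; lia.
Qed.

(** Multiplying by ['X^s] keeps track of the degree already used up by earlier
    factors, and makes the Cauchy product have the same bounds [a.+1] for every
    index. Iterating it yields the multiple sums of [Acoef] and [Bcoef], whose
    constraint sits on the innermost index. *)
Lemma coef_XnM_mul (A : nzRingType) (p q : {poly A}) s a :
  ('X^s * (p * q))`_a = \sum_(i < a.+1) p`_i * ('X^(s + i) * q)`_a.
Proof.
rewrite coefXnM; case: ltnP => as_.
  by rewrite big1 // => i _; rewrite coefXnM ifT ?mulr0 //; lia.
rewrite coefM (big_ord_widen a.+1 (fun i => p`_i * q`_(a - s - i))); last exact: leq_subr.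
rewrite big_mkcond; apply: eq_bigr => i _; rewrite coefXnM.
case: (ltnP a (s + i)) => ia.
  by rewrite mulr0 ifF //; apply/negbTE; rewrite -leqNgt; lia.
by rewrite ifT -?subnDA //; lia.
Qed.

Lemma coef_XnM_sum (A : nzRingType) (p : {poly A}) s a :
  ('X^s * p)`_a = \sum_(i < a.+1 | (s + i == a)%N) p`_i.
Proof.
rewrite -[in LHS](mulr1 p) coef_XnM_mul [RHS]big_mkcond; apply: eq_bigr => i _.
rewrite mulr1 coefXn eq_sym; case: eqP => _; first by rewrite mulr1.
by rewrite mulr0.
Qed.

Lemma coef_prod3 (A : nzRingType) (p1 p2 p3 : {poly A}) a :
  (p1 * (p2 * p3))`_a =
  \sum_(i1 < a.+1) \sum_(i2 < a.+1) \sum_(i3 < a.+1 | (i1 + i2 + i3 == a)%N)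
    p1`_i1 * (p2`_i2 * p3`_i3).
Proof.
rewrite -[LHS](congr1 (fun q : {poly A} => q`_a) (mul1r _)) -[1](expr0 'X).
rewrite coef_XnM_mul; apply: eq_bigr => i1 _.
rewrite coef_XnM_mul mulr_sumr; apply: eq_bigr => i2 _.
by rewrite coef_XnM_sum !mulr_sumr add0n.
Qed.

Lemma coef_prod5 (A : nzRingType) (p1 p2 p3 p4 p5 : {poly A}) a :
  (p1 * (p2 * (p3 * (p4 * p5))))`_a =
  \sum_(i1 < a.+1) \sum_(i2 < a.+1) \sum_(i3 < a.+1) \sum_(i4 < a.+1)
  \sum_(i5 < a.+1 | (i1 + i2 + i3 + i4 + i5 == a)%N)
    p1`_i1 * (p2`_i2 * (p3`_i3 * (p4`_i4 * p5`_i5))).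
Proof.
rewrite -[LHS](congr1 (fun q : {poly A} => q`_a) (mul1r _)) -[1](expr0 'X).
rewrite coef_XnM_mul; apply: eq_bigr => i1 _.
rewrite coef_XnM_mul mulr_sumr; apply: eq_bigr => i2 _.
rewrite coef_XnM_mul !mulr_sumr; apply: eq_bigr => i3 _.
rewrite coef_XnM_mul !mulr_sumr; apply: eq_bigr => i4 _.
by rewrite coef_XnM_sum !mulr_sumr add0n.
Qed.

(** Extracts a factor [c ^+ m] from the power [c ^+ (N - i)]. What is left may
    have a negative exponent; the truncated subtraction is harmless because the
    binomial coefficient vanishes when [i] exceeds [N]. *)
Lemma bin_exprz_split (F : fieldType) (c : F) (N i m : nat) (e : int) :
  c != 0 -> ((i <= N)%N -> N%:Z = m%:Z + e + i%:Z) ->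
  'C(N, i)%:R * c ^+ (N - i) = 'C(N, i)%:R * (c ^+ m * c ^ e).
Proof.
move=> c0 E; case: (leqP i N) => iN; last by rewrite bin_small // !mul0r.
have -> : e = (N - i)%:Z - m%:Z by have := E iN; lia.
by rewrite expfzDr // -exprnN -exprnP [X in _ = _ * X]mulrC divfK ?expf_neq0.
Qed.

Lemma coef_Ptop (A : comNzRingType) (x c1 c2 c3 : A) n h b :
  (Ptop 1 x%:P 'X c1%:P c2%:P c3%:P n h)`_b =
  \sum_(i < b.+1) 'C(n, i)%:R * 'C(n, b - i)%:R *
    ((1 - 2 * x) ^+ 2 * ((1 - x) ^+ h * ((c1 - x) ^+ h *
     ((c2 - x) ^+ (n - i) * (c3 - x) ^+ (n - (b - i)))))).
Proof.
have cX (c : A) m : ((c%:P + 'X) ^+ n)`_m = 'C(n, m)%:R * c ^+ (n - m).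
  by rewrite -['X]mul1r -[1]polyC1 coef_linear_exp expr1n mulr1.
have -> : Ptop 1 x%:P 'X c1%:P c2%:P c3%:P n h =
    ((1 - 2 * x) ^+ 2 * (1 - x) ^+ h * (c1 - x) ^+ h)%:P *
    (((c2 - x)%:P + 'X) ^+ n * ((c3 - x)%:P + 'X) ^+ n).
  rewrite /Ptop !mulr1 !(polyCM, polyC_exp, polyCB) polyC1 polyC_natr.
  by rewrite !mulrA.
rewrite coefCM coefM mulr_sumr; apply: eq_bigr => i _; rewrite !cX; ring.
Qed.

Lemma coef_Dtop (A : comNzRingType) (x c2 c3 : A) n h l b :
  (Dtop 1 x%:P 'X c2%:P c3%:P n h l)`_b =
  'C(n + h + 1, b)%:R * (c2 * ((1 - 2 * x) *
     ((c3 - x) ^+ h * (1 - 2 * x) ^+ (n + h + 1 - b)))).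
Proof.
have -> : Dtop 1 x%:P 'X c2%:P c3%:P n h l =
    (c2 * (1 - 2 * x) * (c3 - x) ^+ h)%:P *
    ((1 - 2 * x)%:P + 1%:P * 'X) ^+ (n + h + 1).
  rewrite /Dtop expr1n !mulr1 polyC1 mul1r !(polyCM, polyC_exp, polyCB) polyC1.
  by rewrite polyC_natr.
rewrite coefCM coef_linear_exp expr1n; ring.
Qed.

(** The common factor [lam * th * th ^+ h] is the leading coefficient of [D] in
    [d]: dividing it out is the source of the shifts by [1] and [h] in the
    exponents of [Acoef]. *)
Lemma coef_Ptop_Acoef (R : realFieldType) (lam th : R) n h a b :
  lam != 0 -> th != 0 -> 1 - th != 0 ->
  (Ptop 1 'X%:P 'X (1 - th)%:P%:P (lam * th)%:P%:P th%:P%:P n h)`_b`_a =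
  lam * th * th ^+ h * Acoef lam th n h a b.
Proof.
move=> lam0 th0 th1; rewrite coef_Ptop coef_sum /Acoef mulrA mulr_sumr.
apply: eq_bigr => i _.
have EL (c m : R) : c%:P - m%:P * 'X = c%:P + (- m)%:P * 'X.
  by rewrite polyCN mulNr.
have E1 c : c%:P - 'X = c%:P + (- 1)%:P * 'X :> {poly R}.
  by rewrite -EL polyC1 mul1r.
rewrite -[2 : {poly R}]polyC_natr -[1 : {poly R}]polyC1 EL !E1.
rewrite -!polyC_natr -polyCM coefCM coef_prod5.
have [ni|in_] := ltnP n i; first by rewrite bin_small // !mul0r !mulr0.
have [nbi|bin] := ltnP n (b - i).
  by rewrite ['C(n, b - i)]bin_small // mulr0 !mul0r !mulr0.
rewrite !mulr_sumr; apply: eq_bigr => i1 _.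
rewrite !mulr_sumr; apply: eq_bigr => i2 _.
rewrite !mulr_sumr; apply: eq_bigr => i3 _.
rewrite !mulr_sumr; apply: eq_bigr => i4 _.
rewrite !mulr_sumr; apply: eq_bigr => i5 /eqP sum_a.
rewrite !coef_linear_exp !expr1n !mul1r [(-2) ^+ i1]exprNn.
have -> : (-1) ^+ a = (-1) ^+ i1 * (-1) ^+ i2 * (-1) ^+ i3 * (-1) ^+ i4
    * (-1) ^+ i5 :> R by rewrite -!exprD sum_a.
have ib := ltn_ord i.
(* The extracted powers [c ^+ m] are 1, [th * lam] and [th ^+ h]. *)
have H3 := @bin_exprz_split _ (1 - th) h i3 0 (h%:Z - i3%:Z) th1 ltac:(lia).
have H4 := @bin_exprz_split _ (th * lam) (n - i) i4 1
  (n%:Z - 1 - i%:Z - i4%:Z) ltac:(by rewrite mulf_neq0) ltac:(lia).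
have H5 := @bin_exprz_split _ th (n - (b - i)) i5 h
  ((n%:Z - h%:Z) - (b%:Z - i%:Z) - i5%:Z) th0 ltac:(lia).
rewrite expr0 mul1r in H3; rewrite expr1 in H4; rewrite [lam * th]mulrC.
transitivity ('C(n, i)%:R * 'C(n, b - i)%:R *
  ((-1) ^+ i1 * (-1) ^+ i2 * (-1) ^+ i3 * (-1) ^+ i4 * (-1) ^+ i5) *
  ('C(2, i1)%:R * 2 ^+ i1 * 'C(h, i2)%:R *
   (('C(h, i3)%:R * (1 - th) ^+ (h - i3)) *
    (('C(n - i, i4)%:R * (th * lam) ^+ (n - i - i4)) *
     ('C(n - (b - i), i5)%:R * th ^+ (n - (b - i) - i5)))))).
  move: (_ ^+ (h - i3)) (_ ^+ (n - i - i4)) (_ ^+ (n - (b - i) - i5)).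
  move: ((-1) ^+ i1) ((-1) ^+ i2) ((-1) ^+ i3) ((-1) ^+ i4) ((-1) ^+ i5) (2 ^+ i1).
  move: ('C(n, i)%:R) ('C(n, b - i)%:R) ('C(2, i1)%:R) ('C(h, i2)%:R)
    ('C(h, i3)%:R) ('C(n - i, i4)%:R) ('C(n - (b - i), i5)%:R) => *; ring.
rewrite H3 H4 H5 {H3 H4 H5}.
move: (_ ^ _) (_ ^ _) (_ ^ _) (th ^+ h).
move: ((-1) ^+ i1) ((-1) ^+ i2) ((-1) ^+ i3) ((-1) ^+ i4) ((-1) ^+ i5) (2 ^+ i1).
move: ('C(n, i)%:R) ('C(n, b - i)%:R) ('C(2, i1)%:R) ('C(h, i2)%:R)
  ('C(h, i3)%:R) ('C(n - i, i4)%:R) ('C(n - (b - i), i5)%:R) => *; ring.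
Qed.

Lemma coef_Dtop_Bcoef (R : realFieldType) (lam th : R) n h l a b :
  th != 0 ->
  (Dtop 1 'X%:P 'X (lam * th)%:P%:P th%:P%:P n h l)`_b`_a =
  lam * th * th ^+ h * Bcoef th n h a b.
Proof.
move=> th0; rewrite coef_Dtop /Bcoef.
have E1 c : c%:P - 'X = c%:P + (- 1)%:P * 'X :> {poly R}.
  by rewrite polyCN polyC1 mulN1r.
have E2 : 1 - 2 * 'X = 1%:P + (- 2)%:P * 'X :> {poly R}.
  by rewrite polyCN polyC_natr polyC1 mulNr.
rewrite E2 E1 -!polyC_natr !coefCM coef_prod3.
rewrite !mulr_sumr; apply: eq_bigr => j1 _.
rewrite !mulr_sumr; apply: eq_bigr => j2 _.
rewrite !mulr_sumr; apply: eq_bigr => j3 /eqP sum_a.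
rewrite -[1%:P + _]expr1 !coef_linear_exp !expr1n !mul1r.
rewrite [(-2) ^+ j1]exprNn [(-2) ^+ j3]exprNn exprD.
have -> : (-1) ^+ a = (-1) ^+ j1 * (-1) ^+ j2 * (-1) ^+ j3 :> R.
  by rewrite -!exprD sum_a.
have H := @bin_exprz_split _ th h j2 h (- j2%:Z) th0 ltac:(lia).
rewrite -exprnN in H.
transitivity ('C(n + h + 1, b)%:R * (lam * th) *
  ((-1) ^+ j1 * (-1) ^+ j2 * (-1) ^+ j3) *
  ('C(1, j1)%:R * 2 ^+ j1 * ('C(h, j2)%:R * th ^+ (h - j2)) *
   ('C(n + h + 1 - b, j3)%:R * 2 ^+ j3))).
  move: (_ ^+ (h - j2)) ((-1) ^+ j1) ((-1) ^+ j2) ((-1) ^+ j3) (2 ^+ j1) (2 ^+ j3).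
  move: ('C(n + h + 1, b)%:R) ('C(1, j1)%:R) ('C(h, j2)%:R)
    ('C(n + h + 1 - b, j3)%:R) => *; ring.
rewrite H {H}.
move: (_ ^- _) (th ^+ h) ((-1) ^+ j1) ((-1) ^+ j2) ((-1) ^+ j3) (2 ^+ j1) (2 ^+ j3).
move: ('C(n + h + 1, b)%:R) ('C(1, j1)%:R) ('C(h, j2)%:R)
  ('C(n + h + 1 - b, j3)%:R) => *; ring.
Qed.

Lemma dehomogenize_Ptop (R : comNzRingType) (c1 c2 c3 : R) n h :
  dehomogenize R (Ptop (varD R) (varJ R) (varK R) (Defs.scalar c1)
    (Defs.scalar c2) (Defs.scalar c3) n h) =
  Ptop 1 'X%:P 'X c1%:P%:P c2%:P%:P c3%:P%:P n h.
Proof.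
rewrite -(dehomogenize_varD R) -dehomogenize_varJ -dehomogenize_varK.
rewrite -!dehomogenize_scalar.
exact: rmorph_Ptop.
Qed.

Lemma dehomogenize_Dtop (R : comNzRingType) (c2 c3 : R) n h l :
  dehomogenize R (Dtop (varD R) (varJ R) (varK R)
    (Defs.scalar c2) (Defs.scalar c3) n h l) =
  Dtop 1 'X%:P 'X c2%:P%:P c3%:P%:P n h l.
Proof.
rewrite -(dehomogenize_varD R) -dehomogenize_varJ -dehomogenize_varK.
rewrite -!dehomogenize_scalar.
exact: rmorph_Dtop.
Qed.

(** * The recursion *)

Lemma Dpoly_lead_neq0 (R : realFieldType) (lam th : R) n h l :
  0 < lam -> 0 < th ->
  (Dpoly lam th n h l)`_(l + n + 2 * h + 3)`_0`_0 != 0.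
Proof.
move=> lam0 th0; have [szD] := size_lead_Dpoly n h l lam0 th0.
rewrite /lead_coef szD addnS /= => ->.
by rewrite !coefC /= !mulf_neq0 ?expf_neq0 // gt_eqF.
Qed.

(** This is the coefficient of [j^a k^b] in [Ptop = Qtop * Dtop + rtop] at
    [d = 1]; the bound on [a + b] says that the monomial concerned has degree at
    least the size of [r] in [d]. *)
Lemma Acoef_convolution (R : realFieldType) (lam th : R) (n h l a b : nat) :
  0 < lam -> 0 < th -> th < 1 -> (l < n)%N -> (a + b <= n - l - 1)%N ->
  Acoef lam th n h a b =
  \sum_(u < a.+1) \sum_(v < b.+1)
    Zcoef lam th n h l u v * Bcoef th n h (a - u) (b - v).
Proof.
move=> lam0 th0 th1 ln abM.
have [lamN0 thN0] : lam != 0 /\ th != 0 by rewrite !gt_eqF.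
have th1N0 : 1 - th != 0 by rewrite subr_eq0 gt_eqF.
have [r szr defP] := Qpoly_long_division n h l lam0 th0.
rewrite (proj1 (size_lead_Dpoly n h l lam0 th0)) addnS ltnS in szr.
have tP := has_top_Ppoly lam th n h.
have degE : (2 * n + 2 * h + 2 = n - l - 1 + (l + n + 2 * h + 3))%N by lia.
rewrite degE in tP.
have tD := has_top_Dpoly lam th n h l.
have [z tQ] := top_quotient defP szr tP tD
  (Dpoly_lead_neq0 n h l lam0 th0).
have tr := has_topB tP (has_topM tQ tD).
(* [tr] says that the top part of [P - Q * D = r] is [Ptop - z * Dtop]. *)
rewrite {1}defP [_ + r]addrC addrK in tr.
have r0 := coef_dehomogenize a b tr.
rewrite ifT in r0; last by lia.
rewrite [r`_ _]nth_default ?coef0 in r0; last by apply: leq_trans szr _; lia.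
move/eqP: r0; rewrite rmorphB !coefB subr_eq0 => /eqP.
rewrite dehomogenize_Ptop coef_Ptop_Acoef //.
rewrite [dehomogenize R (z * _)]rmorphM dehomogenize_Dtop.
rewrite coefM coef_sum => E.
have K0 : lam * th * th ^+ h != 0 by rewrite !mulf_neq0 ?expf_neq0.
apply: (mulfI K0); rewrite E exchange_big mulr_sumr; apply: eq_bigr => v _.
rewrite coefM mulr_sumr; apply: eq_bigr => u _.
rewrite coef_Dtop_Bcoef // mulrCA; congr (_ * (_ * _)).
rewrite (coef_dehomogenize u v tQ) ifT //.
by have := ltn_ord u; have := ltn_ord v; lia.
Qed.

Unset Implicit Arguments.

Theorem proposition6 (R : realFieldType) (lam th : R)
    (lam_gt0 : 0 < lam) (lam_le1 : lam <= 1) (th_gt0 : 0 < th) (th_lt1 : th < 1)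
    (n h l : nat) (h_ge1 : (1 <= h)%N) (h_le_n : (h <= n)%N)
    (l_lt_h : (l <= h - 1)%N) :
  Zcoef lam th n h l 0 0 =
    (lam * th) ^+ (n - 1) * th ^+ (n - h) * (1 - th) ^+ h
  /\
  forall a b : nat,
    (a <= h - l - 1)%N -> (b <= n - h)%N -> (a, b) <> (0%N, 0%N) ->
    Zcoef lam th n h l a b =
      Acoef lam th n h a b
      - \sum_(u < a.+1) \sum_(v < b.+1 | (u + v <= a + b - 1)%N)
          Zcoef lam th n h l u v * Bcoef th n h (a - u) (b - v).
Proof.
have ln : (l < n)%N by lia.
have conv a b :=
  @Acoef_convolution R lam th n h l a b lam_gt0 th_gt0 th_lt1 ln.
have B00 : Bcoef th n h 0 0 = 1.
  by rewrite /Bcoef !big_ord1 big_mkcond big_ord1 /= !bin0 !expr0 !mul1r invr1.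
split.
  have := conv 0%N 0%N isT; rewrite !big_ord1 /= subn0 B00 mulr1 => <-.
  rewrite /Acoef !big_ord1 big_mkcond big_ord1 /= !bin0 !expr0 !mul1r !subr0.
  have -> : n%:Z - 1 = (n - 1)%N by lia.
  have -> : n%:Z - h%:Z = (n - h)%N by lia.
  by rewrite -!exprnP [th * lam]mulrC; ring.
move=> a b ale ble ab0.
have abN0 : (0 < a + b)%N.
  by case: a b ab0 {ale ble} => [|a] [|b] // /(_ erefl).
rewrite conv; last by lia.
have -> : \sum_(u < a.+1) \sum_(v < b.+1)
      Zcoef lam th n h l u v * Bcoef th n h (a - u) (b - v) =
    \sum_(u < a.+1) \sum_(v < b.+1 | (u + v <= a + b - 1)%N)
      Zcoef lam th n h l u v * Bcoef th n h (a - u) (b - v)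
    + Zcoef lam th n h l a b.
  (* The only pair in range with [u + v > a + b - 1] is [(a, b)]; this needs
     [0 < a + b], as [a + b - 1] is truncated. *)
  rewrite !pair_big_dep /= (bigID (fun p : 'I_a.+1 * 'I_b.+1 =>
    (p.1 + p.2 <= a + b - 1)%N)) /=; congr (_ + _).
  rewrite (big_pred1 (ord_max, ord_max)) /= ?subnn ?B00 ?mulr1 // => -[u v].
  rewrite /= xpair_eqE -!val_eqE /=.
  by have := ltn_ord u; have := ltn_ord v; lia.
by rewrite addrAC subrr add0r.
Qed.
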